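(* Let $i\geq 3$ and let $G$ be a claw-o-heavy and $Z_i$-c-heavy graph. Then $\mathrm{cl}^{\mathrm c}(G)$ is $Z_i$-free (contains no induced subgraph isomorphic to $Z_i$).
   Context: All graphs are finite and simple. For a graph $G$ on $n=|V(G)|$ vertices, a vertex $v$ is heavy if $d_G(v)\geq n/2$; a pair $\{u,v\}$ is a heavy pair of $G$ if $uv\notin E(G)$ and $d_G(u)+d_G(v)\geq n$. $G$ is claw-o-heavy if every induced $K_{1,3}$ of $G$ contains a heavy pair of $G$. For a graph $S$, $G$ is $S$-c-heavy if for every induced subgraph $G'$ of $G$ isomorphic to $S$ and every maximal clique $C$ of $G'$, every component of $G'-C$ with at least two vertices contains a vertex heavy in $G$. $Z_i$ ($i\geq 1$) is obtained by identifying a vertex of a triangle with an end-vertex of a path on $i+1$ vertices. For $x\in V(G)$, $G'_x$ is obtained from $G$ by adding all missing edges $uv$ with $u,v\in N_G(x)$. For claw-o-heavy $G$ and $x\in V(G)$, let $G^*$ be obtained from $G$ by adding all missing edges $uv$ with $u,v\in N_G(x)$ and $\{u,v\}$ a heavy pair of $G$; $x$ is c-eligible if $N_G(x)$ is not a clique and either $G^*[N_G(x)]$ is connected, or $G^*[N_G(x)]$ consists of two disjoint cliques $C_1,C_2$ and some $z$ with $\{x,z\}$ a heavy pair of $G$ has $zy_1,zy_2\in E(G)$ for some $y_1\in C_1,y_2\in C_2$. The c-closure $\mathrm{cl}^{\mathrm c}(G)$ of a claw-o-heavy graph $G$ is obtained by a sequence $G=G_1,\dots,G_t=\mathrm{cl}^{\mathrm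 c}(G)$ with $G_{j+1}=(G_j)'_{x_j}$ for a c-eligible vertex $x_j$ of $G_j$, where $G_t$ has no c-eligible vertex; it is well defined (Čada). *)

(* Defs.v *)
From Stdlib Require Classical_Prop.
From mathcomp Require Import all_boot.

Set Implicit Arguments.
Unset Strict Implicit.
Unset Printing Implicit Defensive.

Section Graphs.

(* A finite simple graph is a symmetric irreflexive relation [e] on a finType;
   the two properties are hypotheses of the theorem. *)
Variable T : finType.
Implicit Types (e : rel T) (A B C K : {set T}) (x u v z : T).

Definition nbhd e x : {set T} := [set u | e x u].

Definition deg e x : nat := #|nbhd e x|.

Definition heavy e x : bool := #|T| <= 2 * deg e x.

Definition heavy_pair e u v : bool :=
  [&& u != v, ~~ e u v & #|T| <= deg e u + deg e v].

Definition is_clique e C : bool :=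
  [forall u in C, forall v in C, (u != v) ==> e u v].

Definition induced_rel e B : rel T := [rel u v | [&& u \in B, v \in B & e u v]].

Definition induced_connected e B : bool :=
  (B != set0) && [forall u in B, forall v in B, connect (induced_rel e B) u v].

Definition is_component e B K : Prop :=
  exists2 x, x \in B & K = [set u in B | connect (induced_rel e B) x u].

Definition max_clique_in e A C : bool :=
  maxset (fun D : {set T} => (D \subset A) && is_clique e D) C.

Definition induces_copy e (S : finType) (s : rel S) A : Prop :=
  exists f : S -> T,
    [/\ injective f, A = f @: [set: S] & forall a b, e (f a) (f b) = s a b].

Definition graph_free e (S : finType) (s : rel S) : Prop :=
  ~ exists A, induces_copy e s A.

Definition c_heavy e (S : finType) (s : rel S) : Prop :=
  forall A, induces_copy e s A ->
  forall C, max_clique_in e A C ->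
  forall K, is_component e (A :\: C) K -> 2 <= #|K| ->
  exists2 v, v \in K & heavy e v.

(* G'_x *)
Definition local_completion e x : rel T :=
  [rel u v | e u v || [&& u != v, e x u & e x v]].

(* G^* *)
Definition star e x : rel T :=
  [rel u v | e u v || [&& e x u, e x v & heavy_pair e u v]].

Definition two_disjoint_cliques e B C1 C2 : Prop :=
  [/\ B = C1 :|: C2, [disjoint C1 & C2], is_clique e C1, is_clique e C2
    & forall u v, u \in C1 -> v \in C2 -> ~~ e u v].

Definition c_eligible e x : Prop :=
  ~~ is_clique e (nbhd e x) /\
  (induced_connected (star e x) (nbhd e x) \/
   exists C1 C2 : {set T},
     two_disjoint_cliques (star e x) (nbhd e x) C1 C2 /\
     exists z, heavy_pair e x z /\
       exists y1 y2, [/\ y1 \in C1, y2 \in C2, e z y1 & e z y2]).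

Inductive c_reachable : rel T -> rel T -> Prop :=
| c_reach_refl e : c_reachable e e
| c_reach_step e x h :
    c_eligible e x -> c_reachable (local_completion e x) h -> c_reachable e h.

(* [h] is an outcome of the closure procedure started from [e].  By Cada's
   theorem the outcome is unique when [e] is claw-o-heavy. *)
Definition is_c_closure e h : Prop :=
  c_reachable e h /\ forall x, ~ c_eligible h x.

End Graphs.

(* K_{1,3} with centre 0. *)
Definition claw : rel 'I_4 :=
  [rel a b : 'I_4 | (a == 0 :> nat) != (b == 0 :> nat)].

(* Z_i on i+3 vertices: the triangle 0,1,2 and the path 2,3,...,i+2. *)
Definition Z (i : nat) : rel 'I_(i.+3) :=
  [rel a b : 'I_(i.+3) | [|| [&& a != b, a < 3 & b < 3],
                              (2 <= a) && (b == a.+1 :> nat)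
                            | (2 <= b) && (a == b.+1 :> nat)]].
Arguments Z : clear implicits.

Definition claw_o_heavy (T : finType) (e : rel T) : Prop :=
  forall A : {set T}, induces_copy e claw A ->
  exists u v, [/\ u \in A, v \in A & heavy_pair e u v].

Lemma is_c_closure_exists (T : finType) (e : rel T) :
  exists h, is_c_closure e h.
Proof.
apply: Classical_Prop.NNPP.
pose m (f : rel T) := #|[pred p : T * T | ~~ f p.1 p.2]|.
have [n] := ubnP (m e); elim: n e => // n IH e; rewrite ltnS => le_n nh.
apply: (nh); exists e; split; first exact: c_reach_refl.
move=> x elx; apply: (IH (local_completion e x)).
  apply: leq_trans le_n; apply: proper_card; apply/properP; split.
    by apply/subsetP=> -[u v]; rewrite !inE /= negb_or => /andP[].
  case: elx => [/forall_inPn [u ux /forall_inPn[v vx]] + _].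
  rewrite negb_imply => /andP[uv nuv]; exists (u, v); rewrite !inE //=.
  by move: ux vx; rewrite !inE => ux vx; apply/negPn/orP; right; apply/and3P.
by case=> h [rh mh]; apply: nh; exists h; split=> //; apply: c_reach_step rh.
Qed.

(* Main.v *)
Require Import Defs.
From mathcomp Require Import all_boot zify.

(* Let [h] be the closure of [e].  Counting shows that a closed graph has no
   heavy pair, so [h] is claw-free and diamond-free, any two vertices that are
   heavy in [e] are adjacent in [h], and every vertex completed on the way is
   simplicial in [h].

   Suppose [h] contains an induced Z_i with triangle [a b c] and path
   [c p1 .. pi], and let [R] be the maximal clique of [h] through [a b c].
   Going back along the closure sequence, the path becomes an induced path of
   [e] leaving [R] at [c], and the triangle becomes a triangle of [e] inside
   the core of [R]: [a], [b], [c] and the simplicial vertices of [R].  Join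
   them by a shortest path in the core.  In the resulting induced Z_i of [e],
   remove the first edge of its path: c-heaviness gives a heavy vertex [t] of
   the triangle and a heavy vertex [y] on the path, not adjacent to [t] in [e].
   Since [t] and [y] are adjacent in [h], [y] lies in the core; counting common
   neighbours of [t] and [y] then puts [y] in a triangle of the core, so the
   connecting path was not shortest. *)

Set Implicit Arguments.
Unset Strict Implicit.
Unset Printing Implicit Defensive.

(** * Heavy pairs, claws and local completion *)

Section Basics.

Variable T : finType.
Implicit Types (e h : rel T) (x y u v w z : T).

Lemma deg_mono e h u : subrel e h -> deg e u <= deg h u.
Proof. by move=> eh; apply/subset_leq_card/subsetP => v; rewrite !inE; apply: eh. Qed.

Lemma heavy_mono e h u : subrel e h -> heavy e u -> heavy h u.
Proof. by move=> eh; rewrite /heavy; have := deg_mono u eh; lia. Qed.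

Lemma heavy_pair_sym e : symmetric e -> symmetric (heavy_pair e).
Proof. by move=> es u v; rewrite /heavy_pair eq_sym es addnC. Qed.

Lemma heavy_deg e u v : heavy e u -> heavy e v -> #|T| <= deg e u + deg e v.
Proof. by rewrite /heavy; lia. Qed.

Lemma heavy_heavy_pair e u v :
  heavy e u -> heavy e v -> u != v -> ~~ e u v -> heavy_pair e u v.
Proof. by move=> hu hv; rewrite /heavy_pair (heavy_deg hu hv) => -> ->. Qed.

Lemma heavy_pair_heavy e u v : heavy_pair e u v -> heavy e u || heavy e v.
Proof. by case/and3P=> _ _; rewrite /heavy; lia. Qed.

Lemma heavy_pair_mono e h u v :
  subrel e h -> heavy_pair e u v -> ~~ h u v -> heavy_pair h u v.
Proof.
move=> eh /and3P[uv _ n] huv; rewrite /heavy_pair uv huv.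
by have := deg_mono u eh; have := deg_mono v eh; lia.
Qed.

Definition adj_or_heavy e u v : bool := e u v || heavy_pair e u v.

Lemma adj_or_heavy_sym e : symmetric e -> symmetric (adj_or_heavy e).
Proof. by move=> es u v; rewrite /adj_or_heavy es heavy_pair_sym. Qed.

Lemma adj_or_heavy_mono e h u v :
  subrel e h -> adj_or_heavy e u v -> adj_or_heavy h u v.
Proof.
rewrite /adj_or_heavy => eh /orP[/eh ->//|uv]; case: (boolP (h u v)) => //= ?.
exact: heavy_pair_mono uv _.
Qed.

(** Ranges over any three distinct neighbours of a vertex, not only over independent ones; in this
    form the property passes to local completions. *)
Definition claws_heavy e : Prop :=
  forall y u v w, e y u -> e y v -> e y w -> u != v -> u != w -> v != w ->
  [|| adj_or_heavy e u v, adj_or_heavy e u w | adj_or_heavy e v w].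

(** If all three alternatives fail, the four vertices induce a claw, and its heavy pair, being
    non-adjacent, avoids the centre. *)
Lemma claw_o_heavyW e :
  symmetric e -> irreflexive e -> claw_o_heavy e -> claws_heavy e.
Proof.
move=> es ei ec y u v w yu yv yw uv uw vw; apply: contraT.
rewrite !negb_or => /and3P[/andP[euv huv] /andP[euw huw] /andP[evw hvw]].
pose f (k : 'I_4) := nth y [:: y; u; v; w] k.
have nyu : y != u by apply: contraL yu => /eqP ->; rewrite ei.
have nyv : y != v by apply: contraL yv => /eqP ->; rewrite ei.
have nyw : y != w by apply: contraL yw => /eqP ->; rewrite ei.
have fi : injective f.
  move=> j k /eqP; rewrite nth_uniq ?ltn_ord //; first by move/eqP/val_inj.
  by rewrite /= !inE !negb_or nyu nyv nyw uv uw vw.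
have [|p [q [+ + pq]]] := ec (f @: [set: 'I_4]).
  have adjE := (yu, yv, yw, negbTE euv, negbTE euw, negbTE evw, ei,
                es u y, es v y, es w y, es v u, es w u, es w v).
  by exists f; split=> // -[[|[|[|[|j]]]] lj] [[|[|[|[|k]]]] lk] //;
    rewrite /f /= !adjE.
have fE z : z \in f @: [set: 'I_4] -> [|| z == y, z == u, z == v | z == w].
  by case/imsetP=> -[[|[|[|[|j]]]] lj] _ ->; rewrite /f //= eqxx ?orbT.
have hs := heavy_pair_sym es; move: (pq) => /and3P[npq epq _].
have pairE := (eqxx, yu, yv, yw, es u y, es v y, es w y,
               negbTE huv, negbTE huw, negbTE hvw, hs v u, hs w u, hs w v).
by case/fE/or4P=> /eqP pE; subst p; case/fE/or4P=> /eqP qE; subst q;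
  move: npq epq pq; rewrite !pairE.
Qed.

Lemma lc_sym e x : symmetric e -> symmetric (local_completion e x).
Proof.
by move=> es u v; rewrite /local_completion /= es eq_sym [e x u && _]andbC.
Qed.

Lemma lc_irr e x : irreflexive e -> irreflexive (local_completion e x).
Proof. by move=> ei u; rewrite /local_completion /= ei eqxx. Qed.

Lemma sub_lc e x : subrel e (local_completion e x).
Proof. by move=> u v uv; rewrite /local_completion /= uv. Qed.

(** After the completion, [u] is adjacent to [x] and to all neighbours of [x] other than [u]. *)
Lemma deg_lc e x u : symmetric e -> irreflexive e -> e x u ->
  deg e x <= deg (local_completion e x) u.
Proof.
move=> es ei xu.
have : x |: (nbhd e x :\ u) \subset nbhd (local_completion e x) u.
  apply/subsetP=> v; rewrite !inE /local_completion /= => /orP[/eqP ->|/andP[vu xv]].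
    by rewrite es xu.
  by rewrite eq_sym vu xu xv orbT.
move/subset_leq_card; rewrite cardsU1 !inE ei andbF /=; move: (cardsD1 u (nbhd e x)).
by rewrite !inE xu /deg; lia.
Qed.

(** When an edge [y u] at the centre is new, [x] replaces [u] among the leaves in [e]. A heavy pair
    with [x] then becomes one with [u], since by [deg_lc] the new degree of [u] is at least the old
    degree of [x]. *)
Lemma lc_claws_heavy e x : symmetric e -> irreflexive e ->
  claws_heavy e -> claws_heavy (local_completion e x).
Proof.
move=> es ei ec; set e' := local_completion e x.
have e's : symmetric e' := lc_sym x es.
have as' := adj_or_heavy_sym e's.
have key y u v w : ~~ e y u -> e' y u -> e' y v -> e' y w ->
    u != v -> u != w -> v != w ->
    [|| adj_or_heavy e' u v, adj_or_heavy e' u w | adj_or_heavy e' v w].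
  move=> nyu; rewrite {1}/e' /local_completion /= (negbTE nyu) /=.
  move=> /and3P[yu xy xu] yv yw uv uw vw.
  case: (boolP (e' u v)) => [euv|euv]; first by rewrite /adj_or_heavy euv.
  case: (boolP (e' u w)) => [euw|euw]; first by rewrite /adj_or_heavy euw orbT.
  have aux z : u != z -> ~~ e' u z -> ~~ e x z * (x != z).
    move=> uz euz; split; apply: contra euz; rewrite /e' /local_completion /=.
      by move=> xz; rewrite uz xu xz orbT.
    by move/eqP<-; rewrite es xu.
  have [xv nxv] := aux _ uv euv; have [xw nxw] := aux _ uw euw.
  have hx z : u != z -> ~~ e' u z -> adj_or_heavy e x z -> adj_or_heavy e' u z.
    move=> uz euz; have [xz nxz] := aux _ uz euz.
    rewrite /adj_or_heavy (negbTE xz) /= => /and3P[_ _ n].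
    rewrite (negbTE (_ : ~~ e' u z)) // /heavy_pair uz euz /=.
    apply: leq_trans n (leq_add (deg_lc es ei xu) _).
    exact/deg_mono/sub_lc.
  have yv' : e y v by move: yv; rewrite /e' /local_completion /= (negbTE xv) !andbF orbF.
  have yw' : e y w by move: yw; rewrite /e' /local_completion /= (negbTE xw) !andbF orbF.
  have yx : e y x by rewrite es.
  case/or3P: (ec _ _ _ _ yx yv' yw' nxv nxw vw) => [/hx->//|/hx->//|vw'].
    by rewrite orbT.
  by rewrite (adj_or_heavy_mono (@sub_lc e x) vw') !orbT.
move=> y u v w yu yv yw uv uw vw.
case: (boolP (e y u)) => yu'; last exact: key yu' _ _ _ _ _ _.
case: (boolP (e y v)) => yv'.
  case: (boolP (e y w)) => yw'.
    by case/or3P: (ec _ _ _ _ yu' yv' yw' uv uw vw) =>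
      /(adj_or_heavy_mono (@sub_lc e x)) ->; rewrite ?orbT.
  have := key y w u v yw' yw yu yv; rewrite !(eq_sym w) => /(_ uw vw uv).
  by rewrite !(as' w) => /or3P[] ->; rewrite ?orbT.
have := key y v u w yv' yv yu yw; rewrite (eq_sym v u) => /(_ uv vw uw).
by rewrite !(as' v u) => /or3P[] ->; rewrite ?orbT.
Qed.

(** * Simplicial vertices and the closure sequence *)

Definition simplicial e x : bool := is_clique e (nbhd e x).

Lemma simplicialP e x : reflect
  (forall u v, e x u -> e x v -> u != v -> e u v) (simplicial e x).
Proof.
apply: (iffP idP) => [s u v xu xv uv|s].
  by move: s => /forall_inP/(_ u); rewrite inE => /(_ xu)/forall_inP/(_ v);
    rewrite inE => /(_ xv)/implyP; apply.
apply/forall_inP=> u; rewrite inE => xu; apply/forall_inP=> v; rewrite inE => xv.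
by apply/implyP; apply: s.
Qed.

(** New neighbours of [x] arise only if [y] is a neighbour of [x]; then [y] equals or is adjacent to
    every old neighbour, so the completion joins old ones to new ones. *)
Lemma lc_simplicial e x y : symmetric e -> simplicial e x ->
  simplicial (local_completion e y) x.
Proof.
move=> es /simplicialP s; apply/simplicialP => u v.
rewrite /local_completion /= => xu xv uv.
case: (boolP (e y u && e y v)) => [_|n]; first by rewrite uv orbT.
apply/orP; left.
case/orP: xu => [xu|/and3P[_ yx yu]]; case/orP: xv => [xv|/and3P[_ yx' yv]].
- exact: s.
- rewrite yv andbT in n.
  have xy : e x y by rewrite es.
  case: (u =P y) => [->//|/eqP uy].
  by move: n; rewrite (s y u) // eq_sym.
- rewrite yu /= in n.
  have xy : e x y by rewrite es.
  case: (v =P y) => [->//|/eqP vy]; first by rewrite es.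
  by move: n; rewrite (s y v) // eq_sym.
- by rewrite yu yv in n.
Qed.

Lemma lc_simplicial_at e x : irreflexive e -> simplicial (local_completion e x) x.
Proof.
move=> ei; apply/simplicialP => u v.
rewrite /local_completion /= ei andbF /= !andbF !orbF => -> -> ->.
by rewrite orbT.
Qed.

Record oheavy e : Prop := OHeavy {
  oh_sym : symmetric e; oh_irr : irreflexive e; oh_claw : claws_heavy e }.

Lemma lc_oheavy e x : oheavy e -> oheavy (local_completion e x).
Proof.
by case=> *; split; [apply: lc_sym | apply: lc_irr | apply: lc_claws_heavy].
Qed.

Lemma reachable_sub e h : c_reachable e h -> subrel e h.
Proof.
elim=> {e h} [e u v //|e x h _ _ IH u v uv].
by apply: IH; apply: sub_lc.
Qed.

Lemma reachable_simplicial e h x :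
  c_reachable e h -> oheavy e -> simplicial e x -> simplicial h x.
Proof.
elim=> {e h} [e //|e y h _ _ IH eo ex]; apply: IH; first exact: lc_oheavy.
by apply: lc_simplicial ex; apply: oh_sym.
Qed.

Lemma reachable_oheavy e h : c_reachable e h -> oheavy e -> oheavy h.
Proof. by elim=> {e h} [e //|e x h _ _ IH /(lc_oheavy x)]. Qed.

(* Invariants of the closure sequence are transported from the closure back to
   [e]; the completed vertex is simplicial in the closure. *)
Lemma reachable_back h (P : rel T -> Prop) : P h ->
  (forall e x, oheavy e -> c_reachable (local_completion e x) h -> c_eligible e x ->
     simplicial h x -> P (local_completion e x) -> P e) ->
  forall e, c_reachable e h -> oheavy e -> P e.
Proof.
move=> + + e r; elim: r => {e h} [e //|e x h ex r IH] Ph step eo.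
apply: (step _ x) => //.
  apply: reachable_simplicial r _ _; first exact: lc_oheavy.
  by apply/lc_simplicial_at/oh_irr.
by apply: IH => //; apply: lc_oheavy.
Qed.

End Basics.

(** * Closed graphs: no heavy pair, no claw, no diamond *)

Section Closed.

Variables (T : finType) (h : rel T).
Hypotheses (ho : oheavy h) (hcl : forall x, ~ c_eligible h x).
Let hs := oh_sym ho.
Let hi := oh_irr ho.
Let hc := oh_claw ho.

Let conn x := connect (induced_rel (star h x) (nbhd h x)).

Lemma star_sym x : symmetric (star h x).
Proof. by move=> u v; rewrite /star /= hs heavy_pair_sym // [h x u && _]andbCA. Qed.

Lemma conn_sym x : connect_sym (induced_rel (star h x) (nbhd h x)).
Proof.
by apply: sym_connect_sym => u v; rewrite /induced_rel /= star_sym [(u \in _) && _]andbCA.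
Qed.

Lemma conn_star x u v : h x u -> h x v -> adj_or_heavy h u v -> conn x u v.
Proof.
move=> xu xv uv; apply: connect1; rewrite /induced_rel /star /= !inE xu xv /=.
by case/orP: uv => ->; rewrite ?orbT.
Qed.

(** Otherwise the star graph on the neighbourhood is connected and [x] is eligible. *)
Lemma not_conn x u : ~~ simplicial h x -> h x u ->
  exists2 y, h x y & ~~ conn x u y.
Proof.
move=> sx xu; case: (pickP [pred y | h x y && ~~ conn x u y]) => [y /andP[]|no].
  by exists y.
case: (hcl (x := x)); split=> //; left; apply/andP; split.
  by apply/set0Pn; exists u; rewrite inE.
have c y : h x y -> conn x u y.
  by move=> xy; have := no y; rewrite /= xy /= => /negbFE.
apply/forall_inP=> v; rewrite inE => /c uv; apply/forall_inP=> w.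
rewrite inE => /c; apply: connect_trans; by rewrite conn_sym.
Qed.

(** Some neighbour [y] of [x] lies in another star component; the claw condition on [p], [q], [y]
    leaves only the pair [p], [q]. So star components are cliques. *)
Lemma conn_adj x p q : ~~ simplicial h x -> h x p -> h x q -> p != q ->
  conn x p q -> adj_or_heavy h p q.
Proof.
move=> sx xp xq pq cpq; have [y xy py] := not_conn sx xp.
have py' : p != y by apply: contra py => /eqP <-; apply: connect0.
have qy : q != y by apply: contra py => /eqP <-.
case/or3P: (hc xp xq xy pq py' qy) => // [/(conn_star xp xy) c|/(conn_star xq xy) c].
  by rewrite c in py.
by case/negP: py; apply: connect_trans cpq c.
Qed.

(** Otherwise the star component of [y1] and the rest of the neighbourhood are two cliques linked by
    [z], and [x] is eligible by the second alternative. *)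
Lemma conn_second x z y1 y2 : ~~ simplicial h x -> heavy_pair h x z ->
  h x y1 -> h x y2 -> h z y1 -> h z y2 -> conn x y1 y2.
Proof.
move=> sx xz xy1 xy2 zy1 zy2; apply: contraT => n12.
case: (hcl (x := x)); split=> //; right.
exists [set y in nbhd h x | conn x y1 y], [set y in nbhd h x | ~~ conn x y1 y].
split; last first.
  exists z; split=> //; exists y1, y2; rewrite !inE xy1 xy2 zy1 zy2 n12.
  by split=> //; apply: connect0.
have st u v : h x u -> h x v -> u != v -> adj_or_heavy h u v -> star h x u v.
  by move=> xu xv uv /orP[]; rewrite /star /= => ->; rewrite ?xu ?xv ?orbT.
split.
- by apply/setP=> y; rewrite !inE; case: (h x y) => //=; case: (conn x y1 y).
- apply/pred0P=> y; rewrite /= !inE; case: (h x y) => //=; exact: andbN.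
- apply/forall_inP=> u; rewrite !inE => /andP[xu cu].
  apply/forall_inP=> v; rewrite !inE => /andP[xv cv]; apply/implyP=> uv.
  apply: st => //; apply: (conn_adj sx) => //; apply: connect_trans cv.
  by rewrite conn_sym.
(* Two vertices outside the component of [y1] are joined by the claw condition with [y1] as third
   leaf. *)
- apply/forall_inP=> u; rewrite !inE => /andP[xu cu].
  apply/forall_inP=> v; rewrite !inE => /andP[xv cv]; apply/implyP=> uv.
  apply: st => //.
  have u1 : y1 != u by apply: contra cu => /eqP <-; apply: connect0.
  have v1 : y1 != v by apply: contra cv => /eqP <-; apply: connect0.
  case/or3P: (hc xy1 xu xv u1 v1 uv) => // /(conn_star xy1);
    [move/(_ xu)=> c; by rewrite c in cu | move/(_ xv)=> c; by rewrite c in cv].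
- move=> u v; rewrite !inE => /andP[xu cu] /andP[xv cv]; apply: contra cv => uv.
  by apply: (connect_trans cu); apply: connect1; rewrite /induced_rel /= !inE xu xv.
Qed.

(* A common neighbour [x] of a heavy pair [{u, v}] has a neighbour outside the
   star component of [u], which is a common non-neighbour of [u] and [v];
   distinct [x] get distinct ones, but there are at least two more common
   neighbours than common non-neighbours. *)
Lemma closed_no_heavy_pair u v : ~~ heavy_pair h u v.
Proof.
apply/negP=> uv; have /and3P[nuv huv n] := uv.
pose W := nbhd h u :&: nbhd h v.
pose far x := [pred y | h x y && ~~ conn x u y].
pose g x := odflt u [pick y | far x y].
have WP x : x \in W -> [/\ h u x, h v x, h x u, h x v & ~~ simplicial h x].
  rewrite !inE => /andP[ux vx]; split; rewrite // 1?hs //.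
  by apply/negP=> /simplicialP/(_ u v); rewrite !(hs x) => /(_ ux vx nuv); apply/negP.
have gP x : x \in W -> far x (g x).
  case/WP=> _ _ xu _ sx; rewrite /g; case: pickP => //= no.
  by have [y xy cy] := not_conn sx xu; have := no y; rewrite /= xy cy.
have gN x : x \in W -> g x \in ~: (nbhd h u :|: nbhd h v) :\: [set u; v].
  move=> xW; have [ux vx xu xv sx] := WP _ xW; have /andP[xg cg] := gP _ xW.
  have cuv : conn x u v by apply: conn_star => //; rewrite /adj_or_heavy uv orbT.
  rewrite !inE !negb_or; apply/and3P; split.
  - apply/andP; split; apply: contra cg => /eqP ->; [exact: connect0|exact: cuv].
  - by apply: contra cg => ug; apply: conn_star => //; rewrite /adj_or_heavy ug.
  - apply: contra cg => vg; apply: (connect_trans cuv).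
    by apply: conn_star => //; rewrite /adj_or_heavy vg.
have gi : {in W &, injective g}.
  move=> x x' xW x'W gg; apply/eqP; apply: contraT => nx.
  have [ux vx xu xv sx] := WP _ xW; have /andP[xg cg] := gP _ xW.
  have [ux' vx' x'u x'v sx'] := WP _ x'W; have /andP[x'g cg'] := gP _ x'W.
  rewrite -gg in x'g.
  (* If [x] and [x'] are adjacent, [x'] links [u] to the common value inside the neighbourhood of
     [x]. *)
  case: (boolP (h x x')) => [xx'|nxx'].
    case/negP: cg; apply: (@connect_trans _ _ x').
      by apply: conn_star => //; rewrite /adj_or_heavy ux'.
    by apply: conn_star => //; rewrite /adj_or_heavy x'g.
  (* Otherwise [v] puts [x] and [x'] in one star component at [u], so they form a heavy pair; then
     [x'] plays the outer vertex linking [u] to [g x] at [x]. *)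
  have su : ~~ simplicial h u.
    by apply/negP=> /simplicialP/(_ x x' ux ux' nx); apply/negP.
  have := conn_adj su ux ux' nx (conn_second su uv ux ux' vx vx').
  rewrite /adj_or_heavy (negbTE nxx') /= => /(conn_second sx)/(_ xu xg x'u x'g) cc.
  by case/negP: cg.
have : #|W| <= #|~: (nbhd h u :|: nbhd h v) :\: [set u; v]|.
  rewrite -(card_in_imset gi); apply/subset_leq_card/subsetP=> _ /imsetP[x xW ->].
  exact: gN.
have := cardsUI (nbhd h u) (nbhd h v); have := cardsC (nbhd h u :|: nbhd h v).
have := cardsID [set u; v] (~: (nbhd h u :|: nbhd h v)).
rewrite (setIidPr _).
  (* The margin of two: [u] and [v] are common non-neighbours themselves, outside the range of
     [g]. *)
  by rewrite cards2 nuv; move: n; rewrite /deg -/W; lia.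
by apply/subsetP=> y; rewrite !inE => /orP[]/eqP->; rewrite negb_or hi ?(hs v u) (negbTE huv).
Qed.

Lemma closed_adjE u v : adj_or_heavy h u v = h u v.
Proof. by rewrite /adj_or_heavy (negbTE (closed_no_heavy_pair u v)) orbF. Qed.

Lemma closed_claw_free y u v w : h y u -> h y v -> h y w ->
  u != v -> u != w -> v != w -> [|| h u v, h u w | h v w].
Proof. by move=> yu yv yw; have := hc yu yv yw; rewrite !closed_adjE. Qed.

(** Through [v], the vertices [u] and [w] lie in one star component of [x], and at a non-simplicial
    vertex such components are cliques. *)
Lemma closed_diamond_free x u v w : h x u -> h x v -> h x w ->
  h u v -> h v w -> u != w -> h u w.
Proof.
move=> xu xv xw uv vw nuw; apply: contraT => huw.
have sx : ~~ simplicial h x by apply: contra huw => /simplicialP; apply.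
case/negP: huw; rewrite -closed_adjE; apply: (conn_adj sx) => //.
by apply: (@connect_trans _ _ v); apply: conn_star => //; rewrite closed_adjE.
Qed.

End Closed.

(** * Induced paths and induced copies of [Z i] *)

Lemma connect_inv (T : finType) (r : rel T) (P : pred T) x y :
  (forall u v, P u -> r u v -> P v) -> connect r x y -> P x -> P y.
Proof.
move=> step /connectP[s + ->]; elim: s x => //= z s IH x /andP[xz zs] Px.
exact: IH zs (step _ _ Px xz).
Qed.

Lemma leq_add_cancel m k a b : m + k <= a + b -> b <= k -> m <= a.
Proof. lia. Qed.

(** A total function on indices turns rerouting and splicing into index arithmetic; values beyond
    [n] are ignored. *)
Definition induced_path (T : finType) (e : rel T) (n : nat) (q : nat -> T) : Prop :=
  (forall j l, j <= n -> l <= n -> e (q j) (q l) = (l == j.+1) || (j == l.+1)) /\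
  (forall j l, j <= n -> l <= n -> q j = q l -> j = l).

(** The clique removed is the edge from [r 0] to [r 1], maximal in the copy of [Z i]. It leaves the
    edge [t1 t2] and the path from [r 2] to [r i], which has at least two vertices as [3 <= i]. *)
Lemma c_heavy_Z (T : finType) (e : rel T) i t1 t2 (r : nat -> T) :
  symmetric e -> irreflexive e -> 3 <= i -> c_heavy e (Z i) ->
  e t1 t2 -> e t1 (r 0) -> e t2 (r 0) -> induced_path e i r ->
  (forall j, 0 < j <= i ->
     [&& ~~ e t1 (r j), ~~ e t2 (r j), t1 != r j & t2 != r j]) ->
  (exists2 t, t \in [set t1; t2] & heavy e t) /\
  (exists2 j, 2 <= j <= i & heavy e (r j)).
Proof.
move=> es ei i3 ch e12 e1 e2 [ra ri] off.
(* The numbering of [Z i]: its triangle is [t1], [t2], [r 0], and index [k.+2] stands for [r k]. *)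
pose g k := if k is k'.+2 then r k' else if k is 1 then t2 else t1.
pose f (k : 'I_(i.+3)) := g k.
have neq u v : e u v -> u != v by apply: contraTneq => ->; rewrite ei.
have offr j : j < i ->
    [&& ~~ e t1 (r j.+1), ~~ e t2 (r j.+1), t1 != r j.+1 & t2 != r j.+1].
  by move=> ji; apply: off.
have ga k l : k < i.+3 -> l < i.+3 -> e (g k) (g l) =
    [|| [&& k != l, k < 3 & l < 3], (2 <= k) && (l == k.+1) | (2 <= l) && (k == l.+1)].
  have aux t : t \in [:: t1; t2] -> forall j, j <= i -> e t (r j) = (j == 0).
    rewrite !inE => tt [|j] ji; first by case/orP: tt => /eqP->.
    by have /and4P[n1 n2 _ _] := offr j ji; case/orP: tt => /eqP->; exact/negbTE.
  case: k => [|[|k]]; case: l => [|[|l]] => lk ll //=; rewrite ?ei //.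
  - by rewrite aux ?inE ?eqxx //; lia.
  - by rewrite es.
  - by rewrite aux ?inE ?eqxx ?orbT //; lia.
  - by rewrite es aux ?inE ?eqxx //; lia.
  - by rewrite es aux ?inE ?eqxx ?orbT //; lia.
  - by rewrite ra //; lia.
have gi k l : k < i.+3 -> l < i.+3 -> g k = g l -> k = l.
  have aux t : t \in [:: t1; t2] -> forall j, j <= i -> t <> r j.
    rewrite !inE => tt [|j] ji; first by apply/eqP/neq; case/orP: tt => /eqP->.
    by have /and4P[_ _ n1 n2] := offr j ji; apply/eqP; case/orP: tt => /eqP->.
  have m1 : t1 \in [:: t1; t2] by rewrite inE eqxx.
  have m2 : t2 \in [:: t1; t2] by rewrite !inE eqxx orbT.
  have n12 := neq _ _ e12.
  case: k => [|[|k]]; case: l => [|[|l]] => lk ll //=.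
  - by move=> E; rewrite E eqxx in n12.
  - by move/aux => /(_ m1); case.
  - by move=> E; rewrite E eqxx in n12.
  - by move/aux => /(_ m2); case.
  - by move/esym/aux => /(_ m1); case.
  - by move/esym/aux => /(_ m2); case.
  - by move/ri => /(_ lk ll) ->.
have fi : injective f by move=> k l /(gi _ _ (ltn_ord k) (ltn_ord l))/val_inj.
pose A := f @: [set: 'I_(i.+3)].
have AP k : k < i.+3 -> g k \in A.
  by move=> ki; apply/imsetP; exists (Ordinal ki).
have AE v : v \in A -> exists2 k, k < i.+3 & v = g k.
  by case/imsetP=> k _ ->; exists k.
have cpy : induces_copy e (Z i) A.
  by exists f; split=> // k l; rewrite /f ga.
pose C := [set g 2; g 3].
have CP k : k < i.+3 -> (g k \in C) = (k == 2) || (k == 3).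
  move=> ki; rewrite !inE; congr (_ || _); apply/eqP/eqP => [/gi->//|->//]; lia.
have mC : max_clique_in e A C.
  apply/maxsetP; split.
    apply/andP; split; first by apply/subsetP=> v /set2P[] ->; apply: AP; lia.
    apply/forall_inP=> u /set2P[] ->; apply/forall_inP=> v /set2P[] ->; apply/implyP;
      rewrite ?eqxx // ga //; lia.
  move=> D /andP[/subsetP DA /forall_inP Dc] CD; apply/eqP; rewrite eqEsubset CD andbT.
  apply/subsetP=> v vD; have [k ki vE] := AE _ (DA _ vD).
  have adj l : l < i.+3 -> g l \in D -> v != g l -> e v (g l).
    by move=> li lD; have /forall_inP/(_ _ lD)/implyP := Dc _ vD.
  have D2 : g 2 \in D by apply: (subsetP CD); rewrite CP //; lia.
  have D3 : g 3 \in D by apply: (subsetP CD); rewrite CP //; lia.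
  have g2 : v != g 2 -> e v (g 2) by apply: adj => //; lia.
  have g3 : v != g 3 -> e v (g 3) by apply: adj => //; lia.
  have [->|n2] := eqVneq v (g 2); first by rewrite CP //; lia.
  have [->|n3] := eqVneq v (g 3); first by rewrite CP //; lia.
  have k2 : k != 2 by apply: contraNneq n2 => E; rewrite vE E.
  have k3 : k != 3 by apply: contraNneq n3 => E; rewrite vE E.
  move: (g2 n2) (g3 n3); rewrite vE !ga //; lia.
have DP k : k < i.+3 -> k != 2 -> k != 3 -> g k \in A :\: C.
  by move=> ki k2 k3; rewrite in_setD AP // CP // (negbTE k2) (negbTE k3).
(* An edge avoiding [C] lies in a component with at least two vertices, and that component stays
   within any [P] closed under adjacency outside [C]. *)
have comp (P : pred nat) k l : k < i.+3 -> l < i.+3 ->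
    k != 2 -> k != 3 -> l != 2 -> l != 3 ->
    e (g k) (g l) -> P k ->
    (forall m n, m < i.+3 -> n < i.+3 -> n != 2 -> n != 3 ->
       P m -> e (g m) (g n) -> P n) ->
    exists2 m, P m && (m < i.+3) & heavy e (g m).
  move=> ki li k2 k3 l2 l3 kl Pk cl.
  pose K := [set u in A :\: C | connect (induced_rel e (A :\: C)) (g k) u].
  have [|| v vK hv] := ch A cpy C mC K.
  - by exists (g k) => //; apply: DP.
  - have <- : #|[set g k; g l]| = 2 by rewrite cards2 neq.
    apply/subset_leq_card/subsetP=> v /set2P[] ->; rewrite inE DP //=.
    by apply: connect1; rewrite /induced_rel /= !DP.
  move: vK; rewrite inE => /andP[_ con].
  have : [exists m : 'I_(i.+3), P m && (v == g m)].
    apply: (connect_inv (P := fun v => [exists m : 'I_(i.+3), P m && (v == g m)]) _ con).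
      move=> x y /existsP[m /andP[Pm /eqP->]] /and3P[_ /setDP[/AE[n ni ->] nC] mn].
      rewrite CP // negb_or in nC; case/andP: nC => n2 n3.
      by apply/existsP; exists (Ordinal ni); rewrite eqxx (cl m).
    by apply/existsP; exists (Ordinal ki); rewrite Pk eqxx.
  by case/existsP=> m /andP[Pm /eqP E]; exists m; rewrite ?Pm ?ltn_ord // -E.
split.
  have [|m] := comp (fun m => m < 2) 0 1 isT isT isT isT isT isT e12 isT.
    by move=> m n mi ni n2 n3 m2; rewrite ga //; lia.
  case: m => [|[|m]] // _ hm; [exists t1|exists t2] => //; by rewrite !inE eqxx ?orbT.
(* Indices 4 and 5 are [r 2] and [r 3], the first edge of the remaining path. *)
have i4 : 4 < i.+3 by lia.
have i5 : 5 < i.+3 by lia.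
have g45 : e (g 4) (g 5) by rewrite ga.
have [|m] := comp (fun m => 3 < m) 4 5 i4 i5 isT isT isT isT g45 isT.
  by move=> m n mi ni n2 n3 m2; rewrite ga //; lia.
case: m => [|[|m]] // /andP[m3 mi] hm; exists m => //; lia.
Qed.

(** * Rerouting, splicing and shortest paths *)

Definition insert_at (T : Type) (q : nat -> T) (j : nat) (x : T) (l : nat) : T :=
  if l <= j then q l else if l == j.+1 then x else q l.-1.

(* Undoing a completion at [x] destroys at most one edge of an induced path,
   and then [x] can be inserted there. *)
Lemma induced_path_lc (T : finType) (e : rel T) x i q :
  symmetric e -> irreflexive e -> induced_path (local_completion e x) i q ->
  induced_path e i q \/
  exists j, [/\ j < i, e x (q j.+1) & induced_path e i (insert_at q j x)].
Proof.
move=> es ei [qa qi].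
have lcE u v : local_completion e x u v = e u v || [&& u != v, e x u & e x v] by [].
have [full|] := boolP [forall j : 'I_i, e (q j) (q j.+1)].
  left; split=> // j l ji li.
  have [E|nE] := boolP ((l == j.+1) || (j == l.+1)); last first.
    by apply/negbTE; apply: contra nE => jl; rewrite -qa // lcE jl.
  case/orP: E => /eqP E; subst.
    exact: (forallP full (Ordinal li)).
  by rewrite es; apply: (forallP full (Ordinal ji)).
case/forallPn=> -[j ji] /= nj.
have [xj xj1 nq] : [/\ e x (q j), e x (q j.+1) & q j != q j.+1].
  have := qa j j.+1; rewrite lcE (negbTE nj) eqxx /= => /(_ (ltnW ji) ji).
  by case/and3P.
(* A third neighbour of [x] on the path would form a triangle with [q j] and [q j.+1] in the
   completion. *)
have xl l : l <= i -> e x (q l) = (l == j) || (l == j.+1).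
  move=> li; have [->//|nl] := eqVneq l j; have [->//|nl1] := eqVneq l j.+1.
  apply/negP=> xl.
  have nq1 : q l != q j by apply: contra nl => /eqP/qi ->//; lia.
  have nq2 : q l != q j.+1 by apply: contra nl1 => /eqP/qi ->.
  have := qa l j li (ltnW ji); have := qa l j.+1 li ji.
  by rewrite !lcE nq1 nq2 xl xj xj1 !orbT; lia.
have xq l : l <= i -> x != q l.
  move=> li; apply/eqP=> E.
  have := qa l j li (ltnW ji); have := qa l j.+1 li ji.
  by rewrite !lcE -E xj xj1 /=; lia.
have ea l m : l <= i -> m <= i ->
    e (q l) (q m) = ((m == l.+1) || (l == m.+1)) &&
      ~~ ((l == j) && (m == j.+1) || (m == j) && (l == j.+1)).
  move=> li mi.
  have [/andP[/eqP-> /eqP->]|n1] /= := boolP ((l == j) && (m == j.+1)).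
    by rewrite andbF (negbTE nj).
  have [/andP[/eqP-> /eqP->]|n2] /= := boolP ((m == j) && (l == j.+1)).
    by rewrite andbF es (negbTE nj).
  rewrite andbT -qa // lcE; have [->|nlm] := eqVneq (q l) (q m); first by rewrite orbF.
  rewrite !xl //; suff -> : ((l == j) || (l == j.+1)) && ((m == j) || (m == j.+1)) = false.
    by rewrite andbF orbF.
  by have nlm' : l != m by [apply: contraNneq nlm => ->]; lia.
(* The length stays [i]: the insertion shifts the tail and the old last vertex [q i] drops out. *)
right; exists j; split=> //; rewrite /insert_at.
split=> l m li mi.
  have [lj|lj] := leqP l j; have [mj|mj] := leqP m j.
  - by rewrite ea //; lia.
  - have [->|mj1] := eqVneq m j.+1; first by rewrite es xl //; lia.
    by rewrite ea; lia.
  - have [->|lj1] := eqVneq l j.+1; first by rewrite xl //; lia.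
    by rewrite ea; lia.
  - have [lj1|lj1] := eqVneq l j.+1; have [mj1|mj1] := eqVneq m j.+1.
    + by rewrite ei; lia.
    + by rewrite xl; lia.
    + by rewrite es xl; lia.
    + by rewrite ea; lia.
have [lj|lj] := leqP l j; have [mj|mj] := leqP m j.
- by move/qi; apply.
- have [->|mj1] := eqVneq m j.+1; first by move=> E; have := xq l li; rewrite E eqxx.
  by move/qi; lia.
- have [->|lj1] := eqVneq l j.+1; first by move=> E; have := xq m mi; rewrite E eqxx.
  by move/qi; lia.
- have [lj1|lj1] := eqVneq l j.+1; have [mj1|mj1] := eqVneq m j.+1.
  + by rewrite lj1 mj1.
  + by move=> E; have := xq m.-1; rewrite E eqxx; lia.
  + by move=> E; have := xq l.-1; rewrite E eqxx; lia.
  + by move/qi; lia.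
Qed.

(** Runs back along [s] from [s k] to [s 0], which stands for [q 0], then on along [q]. It is read
    only up to the length of [q], so it still has the right length for a [Z i]. *)
Definition splice (T : Type) (s q : nat -> T) (k l : nat) : T :=
  if l <= k then s (k - l) else q (l - k).

Lemma induced_path_splice (T : finType) (e : rel T) k i s q :
  symmetric e -> induced_path e k s -> induced_path e i q -> s 0 = q 0 ->
  (forall j l, 0 < j <= k -> 0 < l <= i -> ~~ e (s j) (q l) && (s j != q l)) ->
  induced_path e i (splice s q k).
Proof.
move=> es [sa si] [qa qi] sq0 off.
have sq j l : j <= k -> 0 < l <= i -> e (s j) (q l) = (j == 0) && (l == 1) /\ s j <> q l.
  move=> jk li; have [->|jp] := posnP j.
    rewrite sq0 qa //; last by lia.
    by split; [lia | move/qi; lia].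
  have js : 0 < j <= k by lia.
  have /andP[n1 /eqP n2] := off _ _ js li; split=> //=.
  by rewrite (negbTE n1); lia.
split=> j l ji li; rewrite /splice.
  have [jk|jk] := leqP j k; have [lk|lk] := leqP l k.
  - by rewrite sa; lia.
  - by rewrite (sq _ _ _ _).1; lia.
  - by rewrite es (sq _ _ _ _).1; lia.
  - by rewrite qa; lia.
have [jk|jk] := leqP j k; have [lk|lk] := leqP l k.
- by move/si; lia.
- by move=> E; case: (sq (k - j) (l - k) _ _).2; rewrite ?E //; lia.
- by move=> E; case: (sq (k - l) (j - k) _ _).2; rewrite -?E //; lia.
- by move/qi; lia.
Qed.

(** Boolean, so that [ex_minnP] can pick the least length. *)
Fixpoint walk (T : finType) (e : rel T) (D : {set T}) c n v : bool :=
  if n is n'.+1 then (v \in D) && [exists u, walk e D c n' u && e u v] else v == c.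

Lemma connect_walk (T : finType) (e : rel T) (D : {set T}) c v :
  connect (induced_rel e D) c v -> exists n, walk e D c n v.
Proof.
case/connectP=> s + ->; elim/last_ind: s => [|s x IH]; first by exists 0 => /=.
rewrite rcons_path last_rcons => /andP[/IH[n wn] /and3P[_ xD ux]].
by exists n.+1; rewrite /= xD; apply/existsP; exists (last c s); rewrite wn.
Qed.

Lemma walk_vertices (T : finType) (e : rel T) (D : {set T}) c n v :
  c \in D -> walk e D c n v ->
  exists s : nat -> T, [/\ s n = v,
      forall j, j <= n -> (s j \in D) && walk e D c j (s j)
    & forall j, j < n -> e (s j) (s j.+1)].
Proof.
move=> cD; elim: n v => [|n IH] v.
  by move=> /= /eqP->; exists (fun _ => c); split=> // -[|//] _; rewrite cD /= eqxx.
move=> wv; have /= /andP[vD /existsP[u /andP[/IH[s [su sD se]] uv]]] := wv.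
exists (fun j => if j <= n then s j else v); split=> [|j jn|j jn].
- by rewrite ltnn.
- case: ifP => jn'; first exact: sD.
  by have -> : j = n.+1 by [lia]; rewrite wv vD.
- have -> : j <= n by []; case: ifP => jn'; first exact: se.
  by have -> : j = n by [lia]; rewrite su.
Qed.

(** A walk of least length in [D] from [c] to a vertex satisfying [P] is an induced path. The last
    clause records what minimality says about all other vertices satisfying [P]. *)
Lemma shortest_path (T : finType) (e : rel T) (D : {set T}) c (P : pred T) v :
  symmetric e -> irreflexive e -> c \in D -> connect (induced_rel e D) c v -> P v ->
  exists k (s : nat -> T), [/\ s 0 = c, P (s k), forall j, j <= k -> s j \in D,
    induced_path e k s
    & forall j u, j <= k -> u \in D -> P u ->
        (u = s j -> k <= j) /\ (e (s j) u -> k <= j.+1)].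
Proof.
move=> es ei cD /connect_walk[n wn] Pv.
have ex : exists n, [exists u, walk e D c n u && P u].
  by exists n; apply/existsP; exists v; rewrite wn.
have /= [k /existsP[w /andP[wk Pw]] kmin] := ex_minnP ex.
have [s [sk sw se]] := walk_vertices cD wk; exists k, s.
have kle m u : walk e D c m u -> P u -> k <= m.
  by move=> wu Pu; apply: kmin; apply/existsP; exists u; rewrite wu.
have sD j : j <= k -> s j \in D by move/sw/andP=> [].
have ws j : j <= k -> walk e D c j (s j) by move/sw/andP=> [].
have wS m u u' : walk e D c m u -> e u u' -> u' \in D -> walk e D c m.+1 u'.
  by move=> wu uu' uD; rewrite /= uD; apply/existsP; exists u; rewrite wu.
(* A shorter walk to [s l], continued along [s], would be a shorter walk to [s k]. *)
have lle m l : l <= k -> walk e D c m (s l) -> l <= m.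
  move=> lk wl; have ext d : l + d <= k -> walk e D c (m + d) (s (l + d)).
    elim: d => [|d IH] dk; first by rewrite !addn0.
    rewrite !addnS in dk *; apply: wS (IH (ltnW dk)) _ _; first exact: se.
    exact: sD.
  have := ext (k - l); rewrite subnKC // sk => /(_ (leqnn k))/kle/(_ Pw); lia.
have sinj j l : j <= k -> l <= k -> s j = s l -> j = l.
  move=> jk lk E; have wj := ws j jk; have wl := ws l lk.
  rewrite E in wj; rewrite -E in wl.
  by have := lle _ _ lk wj; have := lle _ _ jk wl; lia.
split=> //.
- by have /eqP := ws 0 (leq0n k).
- by rewrite sk.
- split=> // j l jk lk; apply/idP/orP => [jl|[]/eqP E]; last 2 first.
  + by subst l; apply: se.
  + by subst j; rewrite es; apply: se.
  have l1 : l <= j.+1 by apply: (lle _ _ lk); apply: wS (ws _ jk) jl (sD _ lk).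
  have j1 : j <= l.+1.
    by apply: (lle _ _ jk); apply: wS (ws _ lk) _ (sD _ jk); rewrite es.
  have : j != l by apply: contraTneq jl => ->; rewrite ei.
  by move=> ?; apply/orP; lia.
- move=> j u jk uD Pu; split=> [E|ju]; first by apply: (kle j u) => //; rewrite E ws.
  by apply: (kle j.+1 u) => //; apply: wS (ws _ jk) ju uD.
Qed.

(** * The clique through the triangle, its frontier and its core *)

Section Region.

Variables (T : finType) (h : rel T).
Hypotheses (ho : oheavy h) (hcl : forall x, ~ c_eligible h x).
Let hs := oh_sym ho.
Let hi := oh_irr ho.
Let hclaw := closed_claw_free ho hcl.
Let hdia := closed_diamond_free ho hcl.

Lemma adj_neq u v : h u v -> u != v.
Proof. by apply: contraTneq => ->; rewrite hi. Qed.

Variables a b c p1 p2 p3 : T.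
Hypotheses (hab : h a b) (hac : h a c) (hbc : h b c) (hcp1 : h c p1)
  (hp12 : h p1 p2) (hp23 : h p2 p3) (hp13 : ~~ h p1 p3) (np13 : p1 != p3)
  (hcp2 : ~~ h c p2).
Hypotheses (hap : {in [:: p1; p2; p3], forall p, ~~ h a p && (p != a)})
  (hbp : {in [:: p1; p2; p3], forall p, ~~ h b p && (p != b)}).

(* The maximal clique of [h] through the triangle. *)
Definition region : {set T} := [set v | [|| v == a, v == b | h a v && h b v]].
Local Notation R := region.

(* By diamond-freeness: the region vertices in a second maximal clique. *)
Definition frontier : {set T} := [set v in R | ~~ simplicial h v].
Local Notation F := frontier.

(** Overlaps the frontier, at least in [c]. Simplicial vertices are included because every vertex
    completed on the way is simplicial in [h]. *)
Definition core : {set T} :=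
  [set v in R | [|| v == a, v == b, v == c | simplicial h v]].
Local Notation B := core.

Lemma region_a : a \in R. Proof. by rewrite inE eqxx. Qed.
Lemma region_b : b \in R. Proof. by rewrite inE eqxx orbT. Qed.
Lemma region_c : c \in R. Proof. by rewrite inE hac hbc !orbT. Qed.

Lemma core_region u : u \in B -> u \in R.
Proof. by rewrite inE => /andP[]. Qed.

Lemma frontier_region f : f \in F -> f \in R.
Proof. by rewrite inE => /andP[]. Qed.

Lemma core_a : a \in B. Proof. by rewrite inE region_a eqxx. Qed.
Lemma core_b : b \in B. Proof. by rewrite inE region_b eqxx orbT. Qed.
Lemma core_c : c \in B. Proof. by rewrite inE region_c eqxx !orbT. Qed.

Lemma core_simplicial u : u \in R -> simplicial h u -> u \in B.
Proof. by rewrite [u \in B]inE => -> ->; rewrite !orbT. Qed.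

Lemma notin_core u : u \in R -> u \notin B -> u \in F.
Proof. by rewrite !inE => ->; rewrite /= !negb_or => /and4P[]. Qed.

Lemma region_adj u : u \in R -> (u != a -> h a u) /\ (u != b -> h b u).
Proof.
rewrite inE => /or3P[/eqP->|/eqP->|/andP[-> ->]] //; rewrite eqxx.
  by split=> // _; rewrite hs.
by split.
Qed.

(** Apart from the cases with [a] or [b], this is diamond-freeness at [a], through [b]. *)
Lemma region_clique u v : u \in R -> v \in R -> u != v -> h u v.
Proof.
move=> /region_adj[ua ub] /region_adj[va vb] uv.
have [ea|na] := eqVneq u a; first by subst u; apply: va; rewrite eq_sym.
have [ea|na'] := eqVneq v a; first by subst v; rewrite hs ua.
have [eb|nb] := eqVneq u b; first by subst u; apply: vb; rewrite eq_sym.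
have [eb|nb'] := eqVneq v b; first by subst v; rewrite hs ub.
apply: (@hdia a u b v); rewrite ?ua ?va ?vb //.
by rewrite hs ub.
Qed.

(** Diamond-freeness at [u], through [v], joins [w] to every vertex of the region. *)
Lemma region_in u v w : u \in R -> v \in R -> u != v -> h u w -> h v w -> w \in R.
Proof.
move=> uR vR uv uw vw; have huv := region_clique uR vR uv.
have key z : z \in R -> w != z -> h z w.
  move=> zR wz.
  have [->//|zu] := eqVneq z u; have [->//|zv] := eqVneq z v.
  apply: (@hdia u z v w) => //; rewrite 1?eq_sym //;
    apply: region_clique => //; by rewrite eq_sym.
rewrite inE; have [//|wa] := eqVneq w a; have [//|wb] := eqVneq w b.
by rewrite !key ?region_a ?region_b.
Qed.

(** Makes the choice of outside neighbours for frontier vertices injective. *)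
Lemma region_out o u v :
  o \notin R -> u \in R -> v \in R -> h u o -> h v o -> u = v.
Proof.
move=> oR uR vR uo vo; apply/eqP; apply: contraT => uv.
by rewrite (region_in uR vR uv uo vo) in oR.
Qed.

Lemma simplicial_region u w : u \in R -> simplicial h u -> h u w -> w \in R.
Proof.
move=> uR /simplicialP su uw; have [ua ub] := region_adj uR.
rewrite inE; have [//|wa] := eqVneq w a; have [//|wb] := eqVneq w b => /=.
apply/andP; split.
  by have [<-//|na] := eqVneq u a; apply: su => //; [rewrite hs ua|rewrite eq_sym].
by have [<-//|nb] := eqVneq u b; apply: su => //; [rewrite hs ub|rewrite eq_sym].
Qed.

Lemma notin_region p : p \in [:: p1; p2; p3] -> p \notin R.
Proof.
move=> pp; have /andP[ap na] := hap pp; have /andP[bp nb] := hbp pp.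
by rewrite inE (negbTE na) (negbTE nb) (negbTE ap).
Qed.

Lemma c_frontier : c \in F.
Proof.
rewrite inE region_c; apply/negP=> s.
have := notin_region (mem_head p1 [:: p2; p3]).
by rewrite (simplicial_region region_c s hcp1).
Qed.

(** Supplies pairs in the core with one more common non-neighbour when counting. *)
Lemma core_p2 u : u \in B -> ~~ h u p2.
Proof.
have p2i : p2 \in [:: p1; p2; p3] by rewrite !inE eqxx orbT.
rewrite inE => /andP[uR] /or4P[/eqP->|/eqP->|/eqP->|su] //.
- by have /andP[] := hap p2i.
- by have /andP[] := hbp p2i.
- by apply: contra (notin_region p2i) => /(simplicial_region uR su).
Qed.

(** If [p2] is the outside neighbour found, claw-freeness at [p2] with leaves [f], [p1], [p3] yields
    [p1] or [p3] instead. Thus [p2] stays free to be counted separately. *)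
Lemma frontier_out f : f \in F -> exists o, [&& o \notin R, o != p2 & h f o].
Proof.
rewrite inE => /andP[fR sf].
have [o oR fo] : exists2 o, o \notin R & h f o.
  apply/exists_inP; apply: contraR sf; rewrite negb_exists_in => /forall_inP no.
  apply/simplicialP=> u v fu fv; apply: region_clique;
    by apply: contraT => /no; rewrite ?fu ?fv.
have [e2|n2] := eqVneq o p2; last by exists o; rewrite oR n2 fo.
subst o; have nf p : p \in [:: p1; p2; p3] -> f != p.
  by move/notin_region; apply: contraNneq => <-.
have p1i : p1 \in [:: p1; p2; p3] by rewrite inE eqxx.
have p3i : p3 \in [:: p1; p2; p3] by rewrite !inE eqxx !orbT.
have : [|| h f p1, h f p3 | h p1 p3] by apply: (@hclaw p2); rewrite ?nf // hs.
rewrite (negbTE hp13) orbF => /orP[fp|fp].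
  by exists p1; rewrite notin_region // fp adj_neq.
by exists p3; rewrite notin_region // fp eq_sym adj_neq.
Qed.

(** * Common neighbours in a stage of the closure sequence *)

Section Stage.

Variable e : rel T.
Hypotheses (eo : oheavy e) (eh : subrel e h).
Let es := oh_sym eo.
Let ei := oh_irr eo.
Let ec := oh_claw eo.
Let I := [set v | simplicial h v].
Local Notation common u v := (nbhd e u :&: nbhd e v).

(* Every frontier vertex other than [u], [v] owns a vertex outside the region
   that is adjacent to neither [u] nor [v]. *)
Lemma common_count u v (X : {set T}) : u \in R -> v \in R -> u != v ->
  #|T| <= deg e u + deg e v -> X \subset p2 |: R ->
  [disjoint X & nbhd e u :|: nbhd e v] ->
  #|X| + #|F :\: [set u; v]| <= #|common u v :&: I| + #|common u v :&: F|.
Proof.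
move=> uR vR uv n XR XN; set W := common u v.
pose g f := odflt f [pick o | [&& o \notin R, o != p2 & h f o]].
have gP f : f \in F -> [&& g f \notin R, g f != p2 & h f (g f)].
  move=> /frontier_out[o oP]; rewrite /g; case: pickP => //= /(_ o).
  by rewrite oP.
have gi : {in F :\: [set u; v] &, injective g}.
  move=> f f' /setDP[fF _] /setDP[fF' _] E.
  have /and3P[o _ fo] := gP _ fF; have /and3P[_ _ fo'] := gP _ fF'.
  rewrite -E in fo'; by apply: (region_out o) => //; apply: frontier_region.
set G := g @: (F :\: [set u; v]).
have cG : #|G| = #|F :\: [set u; v]| by rewrite card_in_imset.
have XG : [disjoint X & G].
  apply/pred0P=> o /=; apply/negP=> /andP[/(subsetP XR)+ /imsetP[f /setDP[fF _] E]].
  have /and3P[oR o2 _] := gP _ fF.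
  by rewrite E !inE (negbTE o2) /=; move: oR; rewrite inE => /negbTE ->.
have sub : X :|: G \subset ~: (nbhd e u :|: nbhd e v).
  apply/subsetP=> o /setUP[oX|/imsetP[f /setDP[fF fuv] ->]].
    by rewrite in_setC (disjointFr XN oX).
  have /and3P[oR _ fo] := gP _ fF; have fR := frontier_region fF.
  move: fuv; rewrite !inE !negb_or => /andP[fu fv]; apply/andP; split.
    by apply: contra fu => /eh uo; rewrite (region_out oR fR uR).
  by apply: contra fv => /eh vo; rewrite (region_out oR fR vR).
have WR : W \subset R.
  apply/subsetP=> w; rewrite !inE => /andP[/eh uw /eh vw].
  by have := region_in uR vR uv uw vw; rewrite inE.
have WF : W :\: I \subset W :&: F.
  apply/subsetP=> w; rewrite !in_setD in_setI => /andP[wI wW]; rewrite wW /=.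
  by move: wI; rewrite !inE => ->; move: (subsetP WR _ wW); rewrite inE => ->.
(* The degree sum gives at least as many common neighbours as common non-neighbours. The latter
   include the disjoint sets [X] and [G]; the former lie in the region, so in [I] or in the
   frontier. *)
have := subset_leq_card sub; have := subset_leq_card WF; have := cardsID I W.
have := cardsUI (nbhd e u) (nbhd e v); have := cardsC (nbhd e u :|: nbhd e v).
have := cardsUI X G; rewrite (disjoint_setI0 XG) cards0 cG; move: n; rewrite /deg -/W.
clear gP gi cG XG sub WR WF XR XN uR vR uv; clearbody W G; lia.
Qed.

Lemma common_frontier_sub u v :
  common u v :&: F \subset F :\: [set u; v].
Proof.
apply/subsetP=> w; rewrite in_setI in_setD => /andP[+ ->]; rewrite andbT !inE.
by case/andP=> uw vw; rewrite negb_or; apply/andP; split;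
  [apply: contraTneq uw|apply: contraTneq vw] => ->; rewrite ei.
Qed.

Lemma in_common u v w : u \in R -> v \in R -> u != v ->
  w \in common u v :&: I ->
  [/\ e u w, e v w & w \in B].
Proof.
move=> uR vR uv /setIP[/setIP[+ +] sw].
rewrite ![_ \in nbhd _ _]inE => uw vw; rewrite /I inE in sw.
split=> //; apply: core_simplicial sw; apply: (region_in uR vR uv); exact: eh.
Qed.

(** Being non-adjacent, [u] and [v] are common non-neighbours themselves and serve as [X]. *)
Lemma common_heavy_pair_region u v : u \in R -> v \in R -> heavy_pair e u v ->
  2 + #|F :\: [set u; v]| <= #|common u v :&: I| + #|common u v :&: F|.
Proof.
move=> uR vR /and3P[uv euv n].
have <- : #|[set u; v]| = 2 by rewrite cards2 uv.
apply: common_count => //.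
  by apply/subsetP=> w /set2P[] ->; rewrite in_setU1 ?uR ?vR orbT.
apply/pred0P=> w; rewrite /= !inE.
by case: (w =P u) => [->|_] /=; [|case: (w =P v) => [->|]//];
  rewrite !ei ?[e v u]es (negbTE euv).
Qed.

(** Here [X] consists of [p2], [u] and [v], and the frontier terms of the count cancel. *)
Lemma common_heavy_pair_core u v : u \in B -> v \in B -> heavy_pair e u v ->
  2 < #|common u v :&: I|.
Proof.
move=> uB vB /and3P[uv euv n].
have uR := core_region uB; have vR := core_region vB.
have p2R : p2 \notin R by apply: notin_region; rewrite !inE eqxx orbT.
have c3 : #|p2 |: [set u; v]| = 3.
  rewrite cardsU1 cards2 uv !inE negb_or.
  by rewrite !(contraNneq _ p2R) // => ->.
apply: (@leq_add_cancel _ #|F :\: [set u; v]| _ #|common u v :&: F|); last first.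
  exact/subset_leq_card/common_frontier_sub.
rewrite -c3; apply: common_count => //.
  by apply/subsetP=> w /setU1P[->|/set2P[]->]; rewrite in_setU1 ?eqxx ?uR ?vR ?orbT.
apply/pred0P=> w; rewrite /= !inE.
case: (w =P p2) => [->|_] /=.
  by rewrite !(contraNF (@eh _ _) (core_p2 _)).
by case: (w =P u) => [->|_] /=; [|case: (w =P v) => [->|]//];
  rewrite !ei ?[e v u]es (negbTE euv).
Qed.

(** As [u] and [v] are adjacent, only [p2] is left for [X], which still yields one common
    neighbour. *)
Lemma common_heavy_core u v : u \in B -> v \in B -> e u v ->
  heavy e u -> heavy e v -> exists2 w, w \in B & e u w && e v w.
Proof.
move=> uB vB euv hu hv; have uR := core_region uB; have vR := core_region vB.
have uv : u != v by apply/adj_neq/eh.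
have n := heavy_deg hu hv.
have : 0 < #|common u v :&: I|.
  apply: (@leq_add_cancel _ #|F :\: [set u; v]| _ #|common u v :&: F|); last first.
    exact/subset_leq_card/common_frontier_sub.
  rewrite -(cards1 p2); apply: common_count => //.
    by rewrite sub1set !inE eqxx.
  apply/pred0P=> w; rewrite /= !inE; case: (w =P p2) => [->|//] /=.
  by rewrite !(contraNF (@eh _ _) (core_p2 _)).
case/card_gt0P=> w /(in_common uR vR uv)[uw vw wB]; by exists w => //; rewrite uw vw.
Qed.

(** * Triangles in the core *)

Definition in_core_triangle u : bool :=
  (u \in B) && [exists v in B, exists w in B, [&& e u v, e u w & e v w]].
Local Notation tri := in_core_triangle.

Lemma in_core_triangleI u v w :
  u \in B -> v \in B -> w \in B -> e u v -> e u w -> e v w -> tri u.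
Proof.
move=> uB vB wB uv uw vw; rewrite /tri uB; apply/exists_inP; exists v => //.
by apply/exists_inP; exists w => //; rewrite uv uw vw.
Qed.

(** Apply the claw condition at [u] to three common neighbours in the core. Two of them are
    adjacent, or one is heavy and then shares a core neighbour with the heavy vertex [u]. *)
Lemma heavy_pair_triangle u v : u \in B -> v \in B -> heavy_pair e u v ->
  heavy e u -> tri u.
Proof.
move=> uB vB uv hu; have /and3P[nuv _ _] := uv.
have /card_gt2P[z1 [z2 [z3 [[+ + +] [n12 n23 n31]]]]] := common_heavy_pair_core uB vB uv.
have inC := in_common (core_region uB) (core_region vB) nuv.
move=> /inC[u1 v1 B1] /inC[u2 v2 B2] /inC[u3 v3 B3]; rewrite eq_sym in n31.
have hz z : z \in B -> e u z -> heavy e z -> tri u.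
  move=> zB uz hz; have [w wB /andP[uw zw]] := common_heavy_core uB zB uz hu hz.
  exact: in_core_triangleI uz uw zw.
have hzz z z' : z \in B -> z' \in B -> e u z -> e u z' -> adj_or_heavy e z z' -> tri u.
  move=> zB zB' uz uz' /orP[zz'|/heavy_pair_heavy/orP[]]; last 2 first.
  - exact: hz.
  - exact: hz.
  exact: in_core_triangleI uz uz' zz'.
by case/or3P: (ec u1 u2 u3 n12 n31 n23); apply: hzz.
Qed.

Lemma core_heavy_pair_triangle u v : u \in B -> v \in B -> heavy_pair e u v ->
  exists t, tri t.
Proof.
move=> uB vB uv; case/orP: (heavy_pair_heavy uv) => [hu|hv].
  by exists u; apply: heavy_pair_triangle uv hu.
by exists v; apply: heavy_pair_triangle uB _ hv => //; rewrite heavy_pair_sym.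
Qed.

Hypothesis frontier_nbr : forall f, f \in F -> exists2 o, o \notin R & e f o.

(** Apply the claw condition at [f] with an outside neighbour [o] as third leaf: [o] has [f] as its
    only region neighbour in [h], and a heavy pair of [e] not adjacent in [h] would be a heavy pair
    of [h]. *)
Lemma frontier_adj_or_heavy f u v : f \in F -> u \in R -> v \in R ->
  e f u -> e f v -> u != v -> adj_or_heavy e u v.
Proof.
move=> fF uR vR fu fv uv; have [o oR fo] := frontier_nbr fF.
have fR := frontier_region fF.
have key w : w \in R -> e f w -> ~~ adj_or_heavy e o w.
  move=> wR fw; have how : ~~ h o w.
    apply: contraTN (fw) => ow; have <- : f = w.
      by apply: (region_out oR fR wR); [exact: eh | rewrite hs].
    by rewrite ei.
  apply/negP=> /orP[/eh|ow]; first exact/negP.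
  by have := closed_no_heavy_pair ho hcl o w; rewrite (heavy_pair_mono eh ow).
have no w : w \in R -> o != w by apply: contraTneq => <-.
by case/or3P: (ec fo fu fv (no _ uR) (no _ vR) uv) => //; apply: contraTT => _; apply: key.
Qed.

(** Core neighbours of [u] are pairwise adjacent, or a heavy pair in the core already gives a
    triangle. Two common ones suffice together with [v] in the core, or with [c] if it is a common
    neighbour; otherwise [c] is missing from the frontier term and the count gives a third. *)
Lemma frontier_heavy_pair_triangle u v : u \in R -> u \notin B -> v \in R ->
  heavy_pair e u v -> exists t, tri t.
Proof.
move=> uR uB vR uv; have /and3P[nuv _ _] := uv.
have uF := notin_core uR uB; have inC := in_common uR vR nuv.
have cnt := common_heavy_pair_region uR vR uv.
set W := common u v in cnt inC.
have adj z z' : z \in B -> z' \in B -> e u z -> e u z' -> z != z' ->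
    (exists t, tri t) \/ e z z'.
  move=> zB zB' uz uz' zz'.
  case/orP: (frontier_adj_or_heavy uF (core_region zB) (core_region zB') uz uz' zz').
    by right.
  by left; apply: core_heavy_pair_triangle zB zB' _.
have /card_gt1P[y1 [y2 [+ + n12]]] : 1 < #|W :&: I|.
  apply: (leq_add_cancel cnt).
  exact/subset_leq_card/common_frontier_sub.
have nc w : w \in W :&: I -> c != w.
  rewrite in_setI => /andP[_]; apply: contraTneq => <-.
  by have := c_frontier; rewrite !inE => /andP[].
move=> y1W y2W; have [u1 v1 B1] := inC _ y1W; have [u2 v2 B2] := inC _ y2W.
have [//|e12] := adj _ _ B1 B2 u1 u2 n12.
have [vB|vB] := boolP (v \in B).
  by exists v; apply: in_core_triangleI v1 v2 e12.
have cuv : c \in F :\: [set u; v].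
  rewrite in_setD c_frontier andbT !inE negb_or.
  by apply/andP; split; [move: uB|move: vB]; apply: contraNneq => <-; apply: core_c.
have [cW|cW] := boolP (c \in W).
  have uc : e u c by move: cW; rewrite !inE => /andP[].
  have [//|c1] := adj _ _ core_c B1 uc u1 (nc _ y1W).
  have [//|c2] := adj _ _ core_c B2 uc u2 (nc _ y2W).
  by exists c; apply: (in_core_triangleI core_c B1 B2).
have /card_gt2P[z1 [z2 [z3 [[+ + +] [m12 m23 m31]]]]] : 2 < #|W :&: I|.
  have : W :&: F \subset (F :\: [set u; v]) :\ c.
    rewrite subsetD1 common_frontier_sub /=; by rewrite in_setI (negbTE cW).
  move=> sub; rewrite (cardsD1 c) cuv addnA in cnt.
  exact: leq_add_cancel cnt (subset_leq_card sub).
move=> /inC[uz1 _ Z1] /inC[uz2 _ Z2] /inC[uz3 _ Z3]; rewrite eq_sym in m31.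
have [//|a12] := adj _ _ Z1 Z2 uz1 uz2 m12.
have [//|a13] := adj _ _ Z1 Z3 uz1 uz3 m31.
have [//|a23] := adj _ _ Z2 Z3 uz2 uz3 m23.
by exists z1; apply: in_core_triangleI a12 a13 a23.
Qed.

Lemma region_heavy_pair_triangle u v : u \in R -> v \in R ->
  heavy_pair e u v -> exists t, tri t.
Proof.
move=> uR vR uv; have [uB|uB] := boolP (u \in B); last first.
  exact: frontier_heavy_pair_triangle uv.
have [vB|vB] := boolP (v \in B); first exact: core_heavy_pair_triangle uv.
by apply: (frontier_heavy_pair_triangle vR vB uR); rewrite heavy_pair_sym.
Qed.

(** Without a core triangle the region has no heavy pair. This excludes the second kind of
    eligibility, whose [z] would be adjacent to [x] in [h], and makes the star graph at [x] agree
    with [e]. *)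
Lemma eligible_triangle x t1 t2 : c_eligible e x -> simplicial h x ->
  t1 \in B -> t2 \in B -> t1 != t2 -> e x t1 -> e x t2 -> exists t, tri t.
Proof.
move=> [_ el] sx B1 B2 n12 x1 x2.
have xR : x \in R.
  by apply: (region_in (core_region B1) (core_region B2) n12); rewrite hs; apply: eh.
have xB := core_simplicial xR sx.
have NR y : e x y -> y \in R by move/eh; apply: simplicial_region.
apply/existsP; apply: contraT => /existsPn notri.
have nohp u v : u \in R -> v \in R -> heavy_pair e u v = false.
  move=> uR vR; apply/negP=> /(region_heavy_pair_triangle uR vR)[t].
  exact/negP.
case: el => [/andP[_ con]|[C1 [C2 [_ [z [xz _]]]]]]; last first.
  have hxz : h x z.
    apply: contraT => hxz; have := closed_no_heavy_pair ho hcl x z.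
    by rewrite (heavy_pair_mono eh xz hxz).
  by rewrite nohp ?(simplicial_region xR sx hxz) in xz.
have {con} : connect (induced_rel (star e x) (nbhd e x)) t1 t2.
  by move/forall_inP: con => /(_ t1); rewrite inE => /(_ x1)/forall_inP/(_ t2);
    rewrite inE; apply.
have nB1 y : e x y -> e t1 y -> y \notin B.
  move=> xy y1; apply: contra (notri x) => yB; exact: in_core_triangleI x1 xy y1.
(* From [t1] one only reaches neighbours of [t1] outside the core: these are frontier vertices,
   whose region neighbours are pairwise adjacent, and a core neighbour would form a triangle with
   [x] and [t1]. So [t2] is out of reach. *)
pose inv y := (y == t1) || e t1 y && (y \notin B).
move/connect_inv => /(_ inv) H.
have {H} : inv t2.
  apply: H; last by rewrite /inv eqxx.
  move=> y z yP; rewrite /induced_rel /star /= !inE => /and3P[xy xz yz].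
  have {}yz : e y z.
    by move: yz; rewrite xy xz nohp ?NR // orbF.
  rewrite /inv; have [//|nz1] := eqVneq z t1 => /=.
  have tz : e t1 z.
    case/orP: yP => [/eqP<-//|/andP[ty yB]].
    have yF := notin_core (NR _ xy) yB.
    have yt : e y t1 by rewrite es.
    have := frontier_adj_or_heavy yF (core_region B1) (NR _ xz) yt yz.
    by rewrite eq_sym /adj_or_heavy (nohp _ _ (core_region B1) (NR _ xz)) orbF; apply.
  by rewrite tz nB1.
by rewrite /inv eq_sym (negbTE n12) B2 andbF.
Qed.

End Stage.

(** * Invariants carried back along the closure sequence *)

Lemma reachable_nbr e : c_reachable e h -> oheavy e ->
  forall u o, h u o -> exists2 y, e u y & (y == o) || h y o.
Proof.
move: e; apply: reachable_back => [u o uo|e x eo r el sx IH u o uo].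
  by exists o; rewrite ?eqxx.
have es := oh_sym eo; have eh := reachable_sub (c_reach_step el r).
have [y] := IH _ _ uo; rewrite /local_completion /= => /orP[uy|/and3P[uy xu xy]] yo.
  by exists y.
(* The edge [u y] was created at [x]. Now [x] replaces [y]: if distinct from [o], it is adjacent to
   [o] by diamond-freeness, or because [y] is [o]. *)
exists x; first by rewrite es.
have ux : h u x by rewrite hs; apply: eh.
have [//|nxo] := eqVneq x o => /=.
case/orP: yo => [/eqP<-|yo]; first exact: eh.
have hxy := eh _ _ xy.
have hyu : h y u by rewrite hs; apply: (simplicialP _ _ sx) => //; apply: eh.
apply: (@hdia y x u o) => //; by rewrite hs.
Qed.

(** If the neighbour [y] given by [reachable_nbr] were in the region, [o] would have two neighbours
    there, [f] and [y]. *)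
Lemma reachable_frontier_nbr e : c_reachable e h -> oheavy e ->
  forall f, f \in F -> exists2 o, o \notin R & e f o.
Proof.
move=> r eo f fF; have [o /and3P[oR _ fo]] := frontier_out fF.
have fR := frontier_region fF.
have [y fy yo] := reachable_nbr r eo fo; exists y => //.
case/orP: yo => [/eqP->//|yo]; apply/negP=> yR.
by move: fy; rewrite (region_out oR fR yR fo yo) (oh_irr eo).
Qed.

(** A lost core edge is replaced by a detour through [x], which has two neighbours in the region and
    is simplicial in [h], hence lies in the core. *)
Lemma reachable_core_connect e : c_reachable e h -> oheavy e ->
  {in B &, forall u v, connect (induced_rel e B) u v}.
Proof.
move: e; apply: reachable_back => [u v uB vB|e x eo r el sx IH u v uB vB].
  have [->|uv] := eqVneq u v; first exact: connect0.
  by apply: connect1; rewrite /induced_rel /= uB vB region_clique ?core_region.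
have es := oh_sym eo; have eh := reachable_sub (c_reach_step el r).
apply: connect_sub (IH u v uB vB) => y z /and3P[yB zB].
rewrite /local_completion /= => /orP[yz|/and3P[nyz xy xz]].
  by apply: connect1; rewrite /induced_rel /= yB zB.
have xB : x \in B.
  apply: core_simplicial sx; apply: (region_in (core_region yB) (core_region zB) nyz);
    by rewrite hs; apply: eh.
by apply: (@connect_trans _ _ x); apply: connect1; rewrite /induced_rel /= xB ?yB ?zB // es.
Qed.

(** In [h] the triangle [a b c] serves. If undoing a completion destroys an edge of the current
    triangle, [eligible_triangle] supplies another one. *)
Lemma reachable_triangle e : c_reachable e h -> oheavy e ->
  exists t, in_core_triangle e t.
Proof.
move: e; apply: reachable_back => [|e x eo r el sx [t]].
  by exists a; apply: (in_core_triangleI core_a core_b core_c).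
have r' := c_reach_step el r; have eh := reachable_sub r'.
have nbr := reachable_frontier_nbr r' eo.
case/andP=> tB /exists_inP[v vB /exists_inP[w wB]] /and3P[tv tw vw].
have key y z : y \in B -> z \in B -> local_completion e x y z ->
    e y z \/ exists t, in_core_triangle e t.
  move=> yB zB; rewrite /local_completion /= => /orP[|/and3P[yz xy xz]]; first by left.
  by right; apply: eligible_triangle el sx yB zB yz xy xz.
have [tv'|//] := key _ _ tB vB tv; have [tw'|//] := key _ _ tB wB tw.
have [vw'|//] := key _ _ vB wB vw.
by exists t; apply: in_core_triangleI tv' tw' vw'.
Qed.

Definition off_core v : bool :=
  (v \notin B) && [forall w in B, (w != c) ==> ~~ h w v].

Lemma off_coreP v : reflect
  (v \notin B /\ forall w, w \in B -> w != c -> ~~ h w v) (off_core v).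
Proof.
apply: (iffP andP) => -[vB H]; split=> //.
  by move=> w wB; move/forall_inP: H => /(_ w wB)/implyP.
by apply/forall_inP=> w wB; apply/implyP; apply: H.
Qed.

Lemma reachable_path e i : c_reachable e h -> oheavy e ->
  (exists q, [/\ q 0 = c, induced_path h i q & forall j, 0 < j <= i -> off_core (q j)]) ->
  exists q, [/\ q 0 = c, induced_path e i q & forall j, 0 < j <= i -> off_core (q j)].
Proof.
move=> r eo qh; move: e r eo.
apply: reachable_back => [//|e x eo r el sx [q [q0 [qa qi] qo]]].
have es := oh_sym eo; have ei := oh_irr eo.
have eh := reachable_sub (c_reach_step el r).
have [qe|[j [ji xj1 qe]]] := induced_path_lc es ei (conj qa qi); first by exists q.
(* The inserted [x] is not [c], which is not simplicial. Were [x] in the core, or adjacent to a core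
   vertex other than [c], then [q j.+1] would have a core neighbour other than [c]. *)
have xo : off_core x.
  have /off_coreP[qB qn] : off_core (q j.+1) by apply: qo; lia.
  have hxq := eh _ _ xj1; apply/off_coreP; split.
    apply/negP=> xB; have [E|nx] := eqVneq x c; last by have := qn _ xB nx; rewrite hxq.
    by have := c_frontier; rewrite inE -E sx andbF.
  move=> w wB wc; apply/negP=> wx; have := qn _ wB wc.
  rewrite (simplicialP _ _ sx) //; first by rewrite hs.
  by apply: contraNneq qB => <-.
exists (insert_at q j x); split=> // l li; rewrite /insert_at.
case: ifP => lj; first exact: qo.
by case: ifP => lj1 //; apply: qo; lia.
Qed.

(** * The induced [Z i] of [e] and the contradiction *)

Lemma region_contradiction e i : c_reachable e h -> oheavy e -> 3 <= i ->
  c_heavy e (Z i) ->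
  (exists q, [/\ q 0 = c, induced_path h i q & forall j, 0 < j <= i -> off_core (q j)]) ->
  False.
Proof.
move=> r eo i3 ch /(reachable_path r eo)[q [q0 [qa qi] qo]].
have es := oh_sym eo; have ei := oh_irr eo; have eh := reachable_sub r.
have [t tP] := reachable_triangle r eo.
have tB : t \in B by case/andP: tP.
have [k [s [s0 sP sB [sa si] smin]]] :=
  shortest_path es ei core_c (reachable_core_connect r eo core_c tB) tP.
have /andP[skB /exists_inP[t1 B1 /exists_inP[t2 B2 /and3P[k1 k2 e12]]]] := sP.
have T1 : in_core_triangle e t1.
  by apply: (in_core_triangleI B1 skB B2) => //; rewrite es.
have T2 : in_core_triangle e t2.
  by apply: (in_core_triangleI B2 skB B1) => //; rewrite es.
have sNT j : j < k -> ~~ in_core_triangle e (s j).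
  by move=> jk; apply/negP=> /(smin j _ (ltnW jk) (sB _ (ltnW jk)))[/(_ erefl)];
    rewrite leqNgt jk.
(* A triangle vertex adjacent to an earlier [s j] forces [k = j.+1] by minimality; then [s j], [u],
   [s k] is a core triangle met too early. *)
have offT u j : u \in B -> in_core_triangle e u -> e (s k) u -> j < k ->
    ~~ e u (s j) && (u != s j).
  move=> uB uT ku jk; apply/andP; split; last first.
    by apply: contraTneq uT => ->; apply: sNT.
  apply/negP=> us; have [_] := smin j u (ltnW jk) uB uT; rewrite es => /(_ us) kj.
  have kE : k = j.+1 by apply/eqP; rewrite eqn_leq kj jk.
  case/negP: (sNT j jk); apply: (in_core_triangleI (sB _ (ltnW jk)) uB skB) => //.
  - by rewrite es.
  - by rewrite sa // ?kE ?eqxx // ltnW -?kE.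
  - by rewrite es.
have tc u : in_core_triangle e u -> e (s k) u -> u != c.
  move=> uT ku; have [k0|kp] := posnP k; last first.
    by apply: contraTneq uT => ->; rewrite -s0; apply: sNT.
  by move: ku; rewrite k0 s0; apply: contraTneq => ->; rewrite ei.
have sc j : 0 < j <= k -> s j != c.
  by case/andP=> jp jk; rewrite -s0; apply: contraTneq jp => /si ->.
have offQ u j : u \in B -> u != c -> 0 < j <= i -> ~~ h u (q j) && (u != q j).
  move=> uB uc /qo/off_coreP[qB /(_ u uB uc) ->] /=.
  by apply: contraNneq qB => <-.
pose p := splice s q k.
have pP : induced_path e i p.
  apply: induced_path_splice; rewrite ?s0 // => j l jk li.
  have jB : s j \in B by apply: sB; case/andP: jk.
  have /andP[n1 ->] := offQ _ _ jB (sc _ jk) li; rewrite andbT.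
  by apply: contra n1; apply: eh.
have offp u : u \in B -> in_core_triangle e u -> e (s k) u ->
    forall j, 0 < j <= i -> ~~ e u (p j) && (u != p j).
  move=> uB uT ku j /andP[jp ji]; rewrite /p /splice; have [jk|jk] := leqP j k.
    by apply: offT => //; rewrite ltn_subrL jp (leq_trans jp).
  have jk' : 0 < j - k <= i by rewrite subn_gt0 jk (leq_trans (leq_subr _ _)).
  have /andP[n1 ->] := offQ _ _ uB (tc _ uT ku) jk'; rewrite andbT.
  by apply: contra n1; apply: eh.
have p0 : p 0 = s k by rewrite /p /splice subn0.
have [|||[u uT hu] [j ji hj]] := c_heavy_Z es ei i3 ch e12 _ _ pP.
- by rewrite p0 es.
- by rewrite p0 es.
- move=> j ji; have /andP[-> ->] := offp _ B1 T1 k1 _ ji.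
  by have /andP[-> ->] := offp _ B2 T2 k2 _ ji.
have [uB uTr ku] : [/\ u \in B, in_core_triangle e u & e (s k) u].
  by case/set2P: uT => ->.
have [j2 ji'] := andP ji; have jp : 0 < j := ltnW j2.
have j1 : 0 < j <= i by rewrite jp.
have /andP[euj nuj] := offp _ uB uTr ku _ j1.
(* The heavy path vertex either lies on the connecting path, where its heavy pair with [u] gives a
   core triangle too early, or on [q], where it is not adjacent to [u] even in [h]. *)
move: hj euj nuj; rewrite /p /splice; have [jk|jk] := leqP j k => hj euj nuj.
  have kj : k - j < k by rewrite ltn_subrL jp (leq_trans jp).
  case/negP: (sNT _ kj); apply: (heavy_pair_triangle eo eh (sB _ (ltnW kj)) uB _ hj).
  by apply: heavy_heavy_pair => //; rewrite 1?eq_sym // es.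
have jk' : 0 < j - k <= i by rewrite subn_gt0 jk (leq_trans (leq_subr _ _)).
have /andP[huj _] := offQ _ _ uB (tc _ uTr ku) jk'.
have := closed_no_heavy_pair ho hcl u (q (j - k)).
by rewrite heavy_heavy_pair //; apply: heavy_mono eh _.
Qed.

End Region.

(** * From an induced [Z i] of the closure to the region *)

Theorem theorem14 (T : finType) (e : rel T)
    (e_sym : symmetric e) (e_irr : irreflexive e)
    (i : nat) (i_ge3 : 3 <= i)
    (e_claw : claw_o_heavy e) (e_Z : c_heavy e (Z i))
    (h : rel T) (h_cl : is_c_closure e h) :
  graph_free h (Z i).
Proof.
case=> A [f [fi _ fa]]; have [r hcl] := h_cl.
have eo : oheavy e by split=> //; apply: claw_o_heavyW.
have ho := reachable_oheavy r eo.
(* Plain indices for the copy; [inord] is faithful below [i.+3]. *)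
pose g k : T := f (inord k).
have ga k l : k < i.+3 -> l < i.+3 -> h (g k) (g l) =
    [|| [&& k != l, k < 3 & l < 3], (2 <= k) && (l == k.+1) | (2 <= l) && (k == l.+1)].
  by move=> ki li; rewrite /g fa /Z /= -val_eqE /= !inordK.
have gi k l : k < i.+3 -> l < i.+3 -> g k = g l -> k = l.
  by move=> ki li /fi/(congr1 val); rewrite /= !inordK.
have off m : m < 2 -> {in [:: g 3; g 4; g 5], forall p, ~~ h (g m) p && (p != g m)}.
  move=> m2 p; rewrite !inE => /or3P[]/eqP->; rewrite ga; try lia;
    (apply/andP; split; [lia | apply/eqP => /gi; lia]).
have ab : h (g 0) (g 1) by rewrite ga; lia.
have ac : h (g 0) (g 2) by rewrite ga; lia.
have bc : h (g 1) (g 2) by rewrite ga; lia.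
apply: (region_contradiction ho hcl ab ac bc _ _ _ _ _ _
          (off 0 isT) (off 1 isT) r eo i_ge3 e_Z);
  try (rewrite ga; lia); try (apply/eqP => /gi; lia).
exists (fun j => g j.+2); split=> //.
  split=> j l ji li; first by rewrite ga; lia.
  by move/gi; lia.
move=> j ji; have na m : m < 2 -> ~~ h (g m) (g j.+2) by move=> m2; rewrite ga; lia.
have nE m : m < 3 -> g j.+2 != g m by move=> m3; apply/eqP=> /gi; lia.
apply/off_coreP; split.
  by rewrite !inE !(negbTE (nE _ _)) ?(negbTE (na _ _)).
move=> w; rewrite !inE => /andP[wR wc] nwc.
have [->|wa] := eqVneq w (g 0); first exact: na.
have [->|wb] := eqVneq w (g 1); first exact: na.
rewrite (negbTE wa) (negbTE wb) (negbTE nwc) /= in wR wc.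
(* What remains is a simplicial region vertex; if adjacent to a path vertex, it would join that
   vertex to [g 0]. *)
case/andP: wR => aw _; apply: contra (na 0 isT) => wg.
apply: (simplicialP _ _ wc) => //; first by rewrite (oh_sym ho).
by rewrite eq_sym nE.
Qed.
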